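(* Let $k\ge 2$, $n\ge 1$ and $0\le\epsilon\le(k-1)n$ be integers, and let $\epsilon_1,\epsilon_2$ be non-negative integers with $\epsilon=(k-1)\epsilon_1+\epsilon_2$ and $0\le\epsilon_2\le k-1$. Then for every integer $\delta$ with $1\le\delta\le n$ such that either $\delta>\epsilon_1$ or $\epsilon\le(k-1)\delta$, $$\left|\mathcal{P}_{n,\delta}^{k,\epsilon}\right| = [t^{n-\delta}]\,C_k(t)^{k\delta-\epsilon} = \frac{k\delta-\epsilon}{kn-\epsilon}\binom{kn-\epsilon}{n-\delta}.$$
   Context: All lattice paths start at $(0,0)$ and use steps $E=(1,0)$ and $N=(0,1)$. For integers $k\ge 2$, $n\ge 0$, $0\le\epsilon\le (k-1)n$ and any integer $\delta$, let $\mathcal{P}_{n,\delta}^{k,\epsilon}$ denote the set of ordered pairs $(\gamma_1,\gamma_2)$ of such lattice paths satisfying: (1) $\gamma_2$ consists of exactly $(k-1)n$ steps, the first of which is an $E$ step; (2) $\gamma_1$ consists of exactly $(k-1)n-\epsilon$ steps, the first of which is an $N$ step whenever $\gamma_1$ has at least one step ($\gamma_1$ is the empty path when $\epsilon=(k-1)n$); (3) $\gamma_1$ and $\gamma_2$ have no common point other than $(0,0)$; (4) if $\gamma_1$ ends at $(x_1,y_1)$ and $\gamma_2$ ends at $(x_2,y_2)$, then $x_2-x_1=\delta$; (5) writing $\gamma_2=E N^{b_1} E N^{b_2}\cdots E N^{b_m}$ with $b_i\ge 0$, every $b_i$ satisfies $b_i\equiv k-2 \pmod{k-1}$. The $k$-Catalan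 numbers are $C^k_n=\frac{1}{kn+1}\binom{kn+1}{n}$ with generating function $C_k(t)=\sum_{n\ge0}C^k_nt^n$, satisfying $C_k(t)=1+t\,C_k(t)^k$; $[t^m]$ denotes the coefficient of $t^m$. *)

(* Defs.v *)
From HB Require Import structures.
From mathcomp Require Import all_boot all_order all_algebra.

Set Implicit Arguments.
Unset Strict Implicit.
Unset Printing Implicit Defensive.

Import Order.TTheory GRing.Theory Num.Theory.
Local Open Scope ring_scope.

Variant step := E | N.

Definition bool_of_step (s : step) : bool := if s is E then true else false.
Definition step_of_bool (b : bool) : step := if b then E else N.

Lemma bool_of_stepK : cancel bool_of_step step_of_bool.
Proof. by case. Qed.

HB.instance Definition _ := Countable.copy step (can_type bool_of_stepK).
HB.instance Definition _ : isFinite step := CanIsFinite bool_of_stepK.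

(* A lattice path is its sequence of steps; the starting point is (0,0). *)
Definition endpoint (p : seq step) : nat * nat :=
  (count_mem E p, count_mem N p).

Definition points (p : seq step) : seq (nat * nat) :=
  [seq endpoint (take i p) | i <- iota 0 (size p).+1].

(* True of the empty path, for every s. *)
Definition starts_with (s : step) (p : seq step) : bool :=
  if p is x :: _ then x == s else true.

Definition meet_only_at_origin (p q : seq step) : bool :=
  all (fun z => (z \in points q) ==> (z == (0%N, 0%N))) (points p).

(* E N^(b_1) E N^(b_2) ... E N^(b_m) *)
Definition path_of_runs (b : seq nat) : seq step :=
  flatten [seq E :: nseq i N | i <- b].

(* The sequence b_1, ..., b_m of a path E N^(b_1) ... E N^(b_m); see
   path_of_runsK and runsK. *)
Fixpoint runs (p : seq step) : seq nat :=
  match p with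
  | [::] => [::]
  | E :: q => find (pred1 E) q :: runs q
  | N :: q => runs q
  end.

Lemma path_of_runsK : cancel path_of_runs runs.
Proof.
elim=> [|i b IHb] //=; rewrite -/(path_of_runs b).
congr cons.
  rewrite find_cat has_nseq andbF size_nseq.
  by case: b {IHb} => [|j b] /=; rewrite addn0.
by elim: i => [|i IHi].
Qed.

Lemma runsK (p : seq step) : starts_with E p -> path_of_runs (runs p) = p.
Proof.
suff {p} H (p : seq step) :
    nseq (find (pred1 E) p) N ++ path_of_runs (runs p) = p.
  by case: p => [|[] p] //= _; rewrite -[RHS](congr1 (cons E) (H p)).
elim: p => [|[] p IHp] //=; last by rewrite IHp.
by rewrite -[in RHS]IHp.
Qed.

(* The set P_(n,delta)^(k,eps), meant for 2 <= k and eps <= (k - 1) * n; a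
   member g is the pair (gamma_1, gamma_2) = (g.1, g.2). *)
Definition path_pairs (k n eps : nat) (delta : int) :
    {set ((k - 1) * n - eps).-tuple step * ((k - 1) * n).-tuple step} :=
  [set g : _.-tuple step * _.-tuple step |
          [&& starts_with E g.2,
               starts_with N g.1,
               meet_only_at_origin g.1 g.2,
               (endpoint g.2).1%:Z - (endpoint g.1).1%:Z == delta
             & all (fun b => b == k - 2 %[mod k - 1])%N (runs g.2)]].

(* Formal power series over rat, as coefficient sequences: [t^m] f is f m. *)
Definition fps := nat -> rat.

Definition fps1 : fps := fun m => (m == 0%N)%:R.

Definition fps_mul (f g : fps) : fps :=
  fun m => \sum_(i < m.+1) f i * g (m - i)%N.

Definition fps_exp (f : fps) (e : nat) : fps := iter e (fps_mul f) fps1.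

Definition kCatalan (k n : nat) : rat :=
  (k * n + 1)%:R^-1 * 'C(k * n + 1, n)%:R.

Definition kCatalan_fps (k : nat) : fps := fun n => kCatalan k n.

(* Main.v *)
Require Import Defs.
From HB Require Import structures.
From mathcomp Require Import all_boot all_order all_algebra.
From mathcomp Require Import zify ring.

Import Order.TTheory GRing.Theory Num.Theory.
Local Open Scope ring_scope.

(** Condition (5) says that [gamma_2] is a word in the two blocks [E N^(k-2)] and
    [N^(k-1)], i.e. a word of [n] bits.  Insert in front of each group of [k - 1]
    steps of [gamma_1] the negation of the corresponding bit: the pair becomes
    a word of [k n - eps] bits, and the letters [true] count the deficit of
    [x_2 - x_1], so there are [n - delta] of them.  Since [gamma_1] stays above
    [gamma_2] iff it does so at the ends of the blocks, and since
    [eps <= (k-1) delta] makes the bits left after the end of [gamma_1]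
    harmless, the pairs correspond to the words all of whose nonempty prefixes of
    length [i] have fewer than [i / k] letters [true].  Removing the last letter
    of such a word gives the recurrence [A_m(r+1) = A_m(r) + A_(m-1)(r+k)] of the
    Raney numbers [A_m(r) = r / (k m + r) * C(k m + r, m)]; the same recurrence
    gives their convolution identity, hence [A_m(r) = [t^m] C_k(t)^r]. *)

(** * Raney numbers and powers of the [k]-Catalan series *)

(* This form of [r / (k m + r) * C(k m + r, m)] (see [raneyE]) is also right at
   [m = r = 0] and is linear in binomials. *)
Definition raney (k r m : nat) : rat :=
  if m is m'.+1 then 'C(k * m + r, m)%:R - k%:R * 'C((k * m + r).-1, m')%:R
  else 1.

(** The absorption identity [l C(l-1, m) = (m+1) C(l, m+1)] at [l = k (m+1)] makes the two binomials
    cancel. *)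
Lemma raney0 (k m : nat) : (0 < k)%N -> raney k 0 m = (m == 0%N)%:R.
Proof.
case: k m => [|k] [|m] // _; rewrite /raney addn0.
have := mul_bin_diag (k.+1 * m.+1) m.
rewrite mulnAC [RHS]mulnC => /eqP.
rewrite eqn_pmul2r // => /eqP <-.
by rewrite natrM subrr.
Qed.

(** Pascal's rule, applied to each of the two binomials. *)
Lemma raneyS (k r m : nat) : (0 < k)%N ->
  raney k r.+1 m.+1 = raney k r m.+1 + raney k (r + k) m.
Proof.
case: k => [|k] // _; rewrite /raney.
have -> : (k.+1 * m.+1 + r.+1 = (k.+1 * m + r + k).+2)%N by lia.
have -> : (k.+1 * m.+1 + r = (k.+1 * m + r + k).+1)%N by lia.
rewrite /= !binS; case: m => [|m]; first by rewrite !bin0 !natrD; ring.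
have -> : (k.+1 * m.+1 + (r + k.+1) = (k.+1 * m.+1 + r + k).+1)%N by lia.
by rewrite /= !binS !natrD; ring.
Qed.

Lemma raneyE (k r m : nat) : (0 < k * m + r)%N ->
  raney k r m = r%:R / (k * m + r)%:R * 'C(k * m + r, m)%:R.
Proof.
case: m => [|m] h.
  rewrite muln0 add0n in h *.
  by rewrite bin0 mulr1 divff // pnatr_eq0 -lt0n.
rewrite /raney; have := mul_bin_diag (k * m.+1 + r) m.
move: h; move def_l: (k * m.+1 + r)%N => l l0 /(congr1 (fun i => i%:R : rat)).
rewrite !natrM => e.
have l0' : l%:R != 0 :> rat by rewrite pnatr_eq0 -lt0n.
apply: (mulfI l0'); rewrite mulrBr mulrCA e.
have -> : r%:R = l%:R - k%:R * m.+1%:R :> rat by rewrite -def_l natrD natrM; ring.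
by field.
Qed.

(* Both sides satisfy the recurrence [raneyS] in [r] and agree at [r = 0]. *)
Lemma raney_convolution (k s r m : nat) : (0 < k)%N ->
  \sum_(i < m.+1) raney k s i * raney k r (m - i) = raney k (s + r) m.
Proof.
(* [r] stays general because the outer hypothesis is used at [r + k]. *)
move=> k0; elim: m r => [|m IHm] r; first by rewrite big_ord1 mulr1.
elim: r => [|r IHr].
  rewrite big_ord_recr /= subnn mulr1 addn0 big1 ?add0r // => i _.
  by rewrite raney0 // subn_eq0 leqNgt ltn_ord mulr0.
rewrite addnS raneyS // -IHr -addnA -IHm big_ord_recr [in RHS]big_ord_recr /=.
rewrite subnn addrAC -big_split /=; congr (_ + _); apply: eq_bigr => i _.
have -> : (m.+1 - i = (m - i).+1)%N by rewrite subSn // -ltnS.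
by rewrite raneyS // mulrDr.
Qed.

Lemma kCatalan_raney (k m : nat) : kCatalan k m = raney k 1 m.
Proof. by rewrite raneyE ?addn1 // mul1r /kCatalan addn1. Qed.

Lemma fps_exp_kCatalan (k r m : nat) : (0 < k)%N ->
  fps_exp (kCatalan_fps k) r m = raney k r m.
Proof.
move=> k0; elim: r m => [|r IHr] m; first by rewrite raney0.
rewrite -[r.+1]add1n -raney_convolution // [LHS]/=.
by apply: eq_bigr => i _; rewrite IHr /kCatalan_fps kCatalan_raney.
Qed.

(** * Ballot words and their number *)

(* [z] is the current height; the letter [true] steps down by [k - 1] and
   [false] steps up by 1.  The word must stay at positive heights. *)
Fixpoint ballot (k z : nat) (w : seq bool) : bool :=
  if w is b :: w' then (k * b < z.+1)%N && ballot k (z.+1 - k * b) w' else true.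

Lemma ballot_cat (k z : nat) (w1 w2 : seq bool) :
  ballot k z (w1 ++ w2)
  = ballot k z w1 && ballot k (z + size w1 - k * count id w1) w2.
Proof.
elim: w1 z => [|b w1 IH] z /=; first by rewrite addn0 muln0 subn0.
rewrite IH -andbA; case: ltnP => //= h.
by congr (_ && ballot _ _ _); lia.
Qed.

(** The height never becomes negative, so the truncated subtraction in [ballot_cat] is exact. *)
Lemma ballot_count (k z : nat) (w : seq bool) :
  ballot k z w -> (k * count id w <= z + size w)%N.
Proof.
elim: w z => [|b w IH] z /=; first by rewrite muln0.
by case/andP => h /IH; lia.
Qed.

Lemma ballot_rcons (k : nat) (w : seq bool) (b : bool) :
  ballot k 0 (rcons w b)
  = ballot k 0 w && (k * count id (rcons w b) < (size w).+1)%N.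
Proof.
rewrite -cats1 ballot_cat count_cat /= andbT addn0.
case h: ballot => //=; have := ballot_count _ _ _ h; lia.
Qed.

(** Each letter [true] lowers the height by less than [k], so a height that pays [k] for every one
    of them suffices in any order. *)
Lemma ballot_high (k z : nat) (w : seq bool) :
  (k * count id w <= z)%N -> ballot k z w.
Proof.
by elim: w z => //= b w IH z h; rewrite IH; lia.
Qed.

(* Inside a block of at most [k] letters starting from height [k * d], only
   the height at the end of the block matters. *)
Lemma ballot_block (k d t : nat) (c w : seq bool) : (t + size c <= k)%N ->
  ballot k (k * d + t) (c ++ w)
  = (count id c <= d)%N
    && ballot k (k * (d - count id c) + (t + size c)) w.
Proof.
elim: c d t => [|b c IH] d t /=; first by rewrite addn0 subn0.
case: b => /= h.
  rewrite muln1; case: d => [|d]; first by rewrite muln0 ltnNge; case: leqP; lia.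
  have -> : ((k * d.+1 + t).+1 - k = k * d + t.+1)%N by lia.
  rewrite IH; last by lia.
  have -> : (k < (k * d.+1 + t).+1)%N by lia.
  by rewrite add1n ltnS subSS addSnnS.
by rewrite muln0 ltn0Sn subn0 -addnS IH addSnnS.
Qed.

Lemma card_tuple_rcons (T : finType) (l : nat) (P : pred (seq T)) :
  #|[set w : l.+1.-tuple T | P w]|
  = (\sum_b #|[set w : l.-tuple T | P (rcons w b)]|)%N.
Proof.
pose f (x : l.-tuple T * T) := [tuple of rcons x.1 x.2].
have fI : injective f.
  move=> [t x] [u y] /(congr1 val) /= /eqP; rewrite eqseq_rcons.
  by case/andP => /eqP/val_inj -> /eqP ->.
have fB : bijective f.
  by apply: inj_card_bij => //; rewrite card_prod !card_tuple expnSr.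
rewrite -sum1dep_card (reindex f) /=; last by apply: onW_bij.
rewrite -(pair_big_dep xpredT (fun (t : l.-tuple T) x => P (rcons t x))
                       (fun _ _ => 1%N)) /=.
rewrite (exchange_big_dep xpredT) //=.
by apply: eq_bigr => b _; rewrite sum1dep_card.
Qed.

Lemma card_ballot (k l m r : nat) : (0 < k)%N -> l = (k * m + r)%N ->
  #|[set w : l.-tuple bool | ballot k 0 w && (count id w == m)]|%:R
  = raney k r m.
Proof.
move=> k0; elim: l m r => [|l IH] m r.
  move=> /esym/eqP; rewrite addn_eq0 muln_eq0 eqn0Ngt k0 /=.
  move=> /andP [/eqP -> /eqP ->].
  rewrite (_ : [set _ | _] = setT) ?cardsT ?card_tuple //.
  by apply/setP => w; rewrite !inE tuple0.
move=> e.
rewrite (card_tuple_rcons _ _ (fun w => ballot k 0 w && (count id w == m))).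
rewrite big_bool natrD /=.
case: r e => [|r] e.
  (* The final height would be 0, which a nonempty ballot word cannot have. *)
  rewrite raney0 // !eq_card0 ?addr0.
  - by case: m e => //; rewrite muln0.
  - move=> w; rewrite !inE ballot_rcons size_tuple; apply/negP; lia.
  - move=> w; rewrite !inE ballot_rcons size_tuple; apply/negP; lia.
have h0 : [set w : l.-tuple bool |
    ballot k 0 (rcons w false) && (count id (rcons w false) == m)]
  = [set w : l.-tuple bool | ballot k 0 w && (count id w == m)].
  apply/setP => w.
  rewrite !inE ballot_rcons size_tuple -cats1 count_cat /= !addn0.
  by case: eqP => [->|]; rewrite ?andbF // !andbT e addnS ltnS leq_addr andbT.
rewrite h0 (IH m r); last by lia.
case: m e {h0} => [|m] e.
  rewrite eq_card0 ?add0r // => w; rewrite !inE -cats1 count_cat /=; lia.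
(* Without its last letter [true] the word ends at height [r + k], with [m] letters [true]. *)
rewrite raneyS // addrC; congr (_ + _).
rewrite -(IH m (r + k)%N); last by lia.
congr (_%:R); apply: eq_card => w.
rewrite !inE ballot_rcons size_tuple -cats1 count_cat /= addn0 addn1 eqSS.
case: eqP => [->|]; rewrite ?andbF // !andbT.
by rewrite e addnS ltnS leq_addr andbT.
Qed.

(** * Coding a pair of paths by one word *)

(* With [M = k - 1]: the block [E N^(k-2)] for [true], [N^(k-1)] for [false]. *)
Definition expand (M : nat) (bs : seq bool) : seq step :=
  flatten [seq step_of_bool b :: nseq M.-1 N | b <- bs].

(* When fewer than [M] steps of [g] are left, the block is shorter. *)
Fixpoint weave (M : nat) (bs : seq bool) (g : seq step) : seq bool :=
  if bs is b :: bs' then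
    ~~ b :: [seq bool_of_step s | s <- take M g] ++ weave M bs' (drop M g)
  else [::].

(* [g] starts [d] columns to the left of [p], on the same antidiagonal, and
   stays strictly to the left of [p] after each of its steps. *)
Fixpoint above (d : nat) (g p : seq step) : bool :=
  match g, p with
  | x :: g', y :: p' =>
      ((x == E) < d + (y == E))%N && above (d + (y == E) - (x == E)) g' p'
  | _, _ => true
  end.

Lemma expand_cons (M : nat) (b : bool) (bs : seq bool) :
  expand M (b :: bs) = step_of_bool b :: nseq M.-1 N ++ expand M bs.
Proof. by []. Qed.

Lemma size_expand (M : nat) (bs : seq bool) : (0 < M)%N ->
  size (expand M bs) = (M * size bs)%N.
Proof.
move=> M0; elim: bs => [|b bs IH]; first by rewrite muln0.
by rewrite /= size_cat IH size_nseq mulnS -addSn prednK.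
Qed.

Lemma count_expand (M : nat) (bs : seq bool) :
  count_mem E (expand M bs) = count id bs.
Proof.
by elim: bs => //= b bs IH; rewrite count_cat IH count_nseq mul0n; case: b.
Qed.

Lemma expand_inj (M : nat) : injective (expand M).
Proof.
elim=> [|b bs IH] [|c cs] //= [ebc /eqP].
rewrite eqseq_cat // => /andP [_ /eqP/IH ->].
by case: b c ebc => [] [].
Qed.

Lemma expand_nseq_false (M i : nat) : (0 < M)%N ->
  expand M (nseq i false) = nseq (M * i) N.
Proof.
move=> M0; elim: i => [|i IH]; first by rewrite muln0.
have -> : expand M (nseq i.+1 false)
  = nseq M.-1.+1 N ++ expand M (nseq i false) by [].
by rewrite IH -nseqD prednK // mulnS.
Qed.

(** Only whole blocks [N^M] precede the first [E]; if there is no [E], [find] returns the size,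
    again a multiple of [M]. *)
Lemma find_expand (M : nat) (bs : seq bool) : (0 < M)%N ->
  (M %| find (pred1 E) (expand M bs))%N.
Proof.
move=> M0; elim: bs => [|[] bs IH] //=.
rewrite find_cat has_nseq andbF size_nseq -addSn prednK //.
by rewrite dvdn_addr.
Qed.

Lemma runs_expand (M : nat) (bs : seq bool) : (0 < M)%N ->
  all (fun b => b == M.-1 %[mod M])%N (runs (expand M bs)).
Proof.
move=> M0.
have runsN i p : runs (nseq i N ++ p) = runs p by elim: i.
elim: bs => [|[] bs IH] //=; rewrite runsN // IH andbT.
rewrite find_cat has_nseq andbF size_nseq -modnDmr.
by have /eqP -> := find_expand M bs M0; rewrite addn0.
Qed.

Lemma expand_surj (M : nat) (p : seq step) : (0 < M)%N -> starts_with E p ->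
  all (fun b => b == M.-1 %[mod M])%N (runs p) -> exists bs, p = expand M bs.
Proof.
move=> M0 /runsK {2}<-; elim: (runs p) => [|r rs IH] /=; first by exists [::].
(* A run of length [M - 1 + M q] is one block [true] followed by [q] blocks [false], and
   [q = r %/ M]. *)
case/andP => hr /IH [bs e]; exists (true :: nseq (r %/ M) false ++ bs).
rewrite (_ : path_of_runs (r :: rs) = E :: nseq r N ++ path_of_runs rs) //.
rewrite e expand_cons.
have expand_cat us vs : expand M (us ++ vs) = expand M us ++ expand M vs.
  by rewrite /expand map_cat flatten_cat.
rewrite expand_cat expand_nseq_false // catA -nseqD; congr (_ :: nseq _ _ ++ _).
move: hr; rewrite (@modn_small M.-1) ?prednK // => /eqP <-.
by rewrite addnC mulnC -divn_eq.
Qed.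

Lemma size_weave (M : nat) (bs : seq bool) (g : seq step) :
  (size g <= M * size bs)%N -> size (weave M bs g) = (size bs + size g)%N.
Proof.
elim: bs g => [|b bs IH] g /=; first by rewrite muln0; case: g.
move=> h; rewrite size_cat size_map size_take IH size_drop; last by lia.
by case: ltnP; lia.
Qed.

(** A bit enters the woven word negated, so it counts exactly once on the left. This turns the
    condition on [x_2 - x_1] into a number of letters [true]. *)
Lemma count_weave (M : nat) (bs : seq bool) (g : seq step) :
  (size g <= M * size bs)%N ->
  (count id (weave M bs g) + count id bs = size bs + count_mem E g)%N.
Proof.
elim: bs g => [|b bs IH] g /=; first by rewrite muln0; case: g.
move=> h; rewrite count_cat count_map (eq_count (a2 := pred1 E)); last by case.
have := IH (drop M g); have := congr1 (count_mem E) (cat_take_drop M g).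
by rewrite size_drop count_cat; case: b => /=; lia.
Qed.

(** Equal sizes cut both words at the same places, and the size bound ensures that all of [g] is
    read. *)
Lemma weave_inj (M : nat) (bs bs' : seq bool) (g g' : seq step) :
  size bs = size bs' -> size g = size g' -> (size g <= M * size bs)%N ->
  weave M bs g = weave M bs' g' -> bs = bs' /\ g = g'.
Proof.
elim: bs bs' g g' => [|b bs IH] [|b' bs'] g g' //=.
  by move=> _; rewrite muln0; case: g g' => [|? ?] [].
move=> [es] eg h [eb /eqP]; rewrite eqseq_cat; last first.
  by rewrite !size_map !size_take eg.
case/andP => /eqP/(inj_map (can_inj bool_of_stepK)) et /eqP/IH [] //.
- by rewrite !size_drop eg.
- by rewrite size_drop; lia.
move=> -> ed; rewrite -(negbK b) eb negbK; split=> //.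
by rewrite -(cat_take_drop M g) et ed cat_take_drop.
Qed.

(** While the lower path goes north the distance can only shrink, so its final value decides. *)
Lemma above_nseqN (d s : nat) (g p : seq step) : (0 < d)%N ->
  above d g (nseq s N ++ p)
  = (count_mem E (take s g) < d)%N
    && above (d - count_mem E (take s g)) (drop s g) p.
Proof.
elim: s d g => [|s IH] d g d0; first by rewrite take0 drop0 /= d0 subn0.
case: g => [|x g]; first by rewrite /= d0.
rewrite /= addn0; case: (ltnP (x == E) d) => [h|h] /=; last first.
  by case: ltnP => //; lia.
by rewrite IH ?subn_gt0 // subnDA ltn_subRL.
Qed.

Lemma above_block (M d : nat) (b : bool) (x : step) (g p : seq step) :
  (0 < M)%N ->
  above d (x :: g) (step_of_bool b :: nseq M.-1 N ++ p)
  = (count_mem E (take M (x :: g)) < d + b)%N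
    && above (d + b - count_mem E (take M (x :: g))) (drop M (x :: g)) p.
Proof.
case: M => // M _ /=.
have -> : (step_of_bool b == E) = b by case: b.
case: (ltnP (x == E) (d + b)) => [h|h] /=; last by case: ltnP => //; lia.
by rewrite above_nseqN ?subn_gt0 // subnDA ltn_subRL.
Qed.

(* The bound on [eps] is what makes the letters read after the end of [g]
   unable to bring the height of the ballot word to 0. *)
Lemma above_weave (M d eps delta : nat) (bs : seq bool) (g : seq step) :
  (0 < M)%N -> (size g + eps = M * size bs)%N -> (eps <= M * delta)%N ->
  (d + count id bs = delta + count_mem E g)%N ->
  above d g (expand M bs) = ballot M.+1 (M.+1 * d) (weave M bs g).
Proof.
move=> M0 + heps; elim: bs d g => [|b bs IH] d g.
  by rewrite muln0; case: g.
case: g => [|x g] hs hd.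
  (* [g] has ended: at most [delta] bits remain, so by [hd] at most [d] of them are [false]. *)
  rewrite ballot_high //= leq_mul2l; apply/orP; right.
  have hsz : (size (b :: bs) <= delta)%N.
    by rewrite -(leq_pmul2l M0) -hs.
  have := count_weave M (b :: bs) [::] isT; move: hsz hd => /=; lia.
rewrite expand_cons above_block //.
have hdrop := size_drop M (x :: g); have htake := size_take M (x :: g).
have hcount : (count_mem E (take M (x :: g)) + count_mem E (drop M (x :: g))
   = count_mem E (x :: g))%N by rewrite -count_cat cat_take_drop.
rewrite [weave _ _ _]/= -cat_cons -[(M.+1 * d)%N]addn0.
move: (x :: g) hs hd hdrop htake hcount => {}g hs hd hdrop htake hcount.
rewrite ballot_block; last by rewrite /= size_map htake; case: ltnP; lia.
have -> : count id (~~ b :: [seq bool_of_step s | s <- take M g])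
    = (~~ b + count_mem E (take M g))%N.
  by rewrite /= count_map; congr (_ + _)%N; apply: eq_count; case.
move: hd hs => /= hd hs.
rewrite size_map.
set c := count_mem E (take M g) in hcount *.
have -> : (~~ b + c <= d)%N = (c < d + b)%N by case: (b); lia.
case: ltnP => //= hc.
(* After a full block the height is again [M.+1] times the distance, and induction applies;
   otherwise [g] ends inside this block. *)
case: (leqP M (size g)) => hM.
  have -> : (M.+1 * (d - (~~ b + c)) + (0 + (size (take M g)).+1)
             = M.+1 * (d + b - c))%N.
    have -> : size (take M g) = M by rewrite htake; case: ltnP; lia.
    rewrite add0n addnC -mulnS; congr (_ * _)%N.
    by move: hc; case: (b) => /=; lia.
  apply: IH; first by rewrite hdrop; lia.
  by rewrite -hcount in hd; clear -hd hc; lia.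
have dropg : drop M g = [::] by apply: drop_oversize; apply: ltnW.
rewrite dropg /= ballot_high //.
have h := count_weave M bs [::] isT; rewrite /= addn0 in h.
(* [size g < M] forces [eps > M * size bs]. *)
have hsz : (size bs < delta)%N by nia.
have hw : (count id (weave M bs [::]) <= d - (~~ b + c))%N.
  by move: hcount; rewrite dropg /=; move: hc hd; case: (b) => /=; lia.
by nia.
Qed.

(** A first bit [false] would be woven as [true], a forbidden drop from height 0. *)
Lemma ballot_weave_starts (k M : nat) (bs : seq bool) (g : seq step) :
  (0 < k)%N -> ballot k 0 (weave M bs g) -> starts_with E (expand M bs).
Proof. by case: bs k => [|[] bs] [|k]. Qed.

(** * Common points of two paths *)

(** The distance changes by at most 1 per step, so it cannot become negative without vanishing
    first. *)
Lemma above_neq (d : nat) (g p : seq step) : (0 < d)%N -> (size g <= size p)%N ->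
  reflect (forall i, (i <= size g)%N ->
             count_mem E (take i g) <> (d + count_mem E (take i p))%N)
          (above d g p).
Proof.
elim: g p d => [|x g IH] p d d0.
  move=> _; left => -[|i] //= _; rewrite take0 /=; lia.
case: p => [|y p] //= h.
case: (ltnP (x == E) (d + (y == E))) => hxy /=; last first.
  right => /(_ 1%N isT) /=; rewrite !take0 /= !addn0.
  by move: hxy; case: x; case: y => /=; lia.
apply: (iffP (IH _ _ _ h)); first by rewrite subn_gt0.
  move=> H [|i] /=; first by lia.
  by move=> /H; move: (x == E) (y == E) hxy => [] [] /=; lia.
move=> H i hi; have := H i.+1 hi => /=.
by move: (x == E) (y == E) hxy => [] [] /=; lia.
Qed.

(* A common point is reached by both paths after the same number of steps. *)
Lemma meet_only_at_originP (g p : seq step) : (size g <= size p)%N ->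
  reflect (forall i, (0 < i <= size g)%N ->
             count_mem E (take i g) <> count_mem E (take i p))
          (meet_only_at_origin g p).
Proof.
have size_count q : (count_mem E q + count_mem N q)%N = size q.
  rewrite -(count_predC (pred1 E) q); congr (_ + _)%N.
  by apply: eq_count; case.
move=> h; apply: (iffP allP) => H.
  move=> i /andP [i0 hi] e.
  have hz : endpoint (take i g) \in points g.
    by apply/mapP; exists i; rewrite ?mem_iota.
  have /implyP := H _ hz.
  have sg := size_count (take i g); have sp := size_count (take i p).
  have hip := leq_trans hi h; rewrite !size_takel // in sg sp.
  have hz' : endpoint (take i g) \in points p.
    apply/mapP; exists i; first by rewrite mem_iota ltnS /=.
    by rewrite /endpoint; congr pair; lia.
  move=> /(_ hz'); rewrite xpair_eqE => /andP [/eqP h1 /eqP h2].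
  by lia.
move=> z /mapP [i]; rewrite mem_iota ltnS => /= hi ->.
apply/implyP => /mapP [j]; rewrite mem_iota ltnS => /= hj [e1 e2].
have sg := size_count (take i g); have sp := size_count (take j p).
rewrite !size_takel // in sg sp.
have ij : i = j by rewrite -sg -sp e1 e2.
case: (posnP i) => [->|i0]; first by rewrite take0.
by case: (H i); rewrite ?i0 // e1 ij.
Qed.

(** From distance 0 only [N] against [E] gives a positive distance, namely 1; [above_neq] then
    applies with [d = 1]. *)
Lemma above_meet (g p : seq step) : starts_with E p -> p != [::] ->
  (size g <= size p)%N ->
  starts_with N g && meet_only_at_origin g p = above 0 g p.
Proof.
case: p g => [|[] p] // [|x g] _ _ h.
  by apply/allP => z; rewrite inE => /eqP ->; rewrite implybT.
case: x h => // h; rewrite [above _ _ _]/= /=.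
apply/meet_only_at_originP/above_neq => //.
  by move=> H i hi; have := H i.+1 hi; rewrite /=; lia.
by move=> H [|i] //= /H.
Qed.

(** * The bijection and the final count *)

Lemma card_path_pairs (k n eps delta : nat) : (2 <= k)%N -> (0 < n)%N ->
  (eps <= (k - 1) * n)%N -> (delta <= n)%N -> (eps <= (k - 1) * delta)%N ->
  #|path_pairs k n eps delta%:Z|
  = #|[set w : (n + ((k - 1) * n - eps)).-tuple bool |
        ballot k 0 w && (count id w == n - delta)%N]|.
Proof.
move=> k2 n0 hen hdn hed.
pose M := (k - 1)%N; pose L := ((k - 1) * n - eps)%N.
have M0 : (0 < M)%N by rewrite subn_gt0.
have LM : (L <= M * n)%N by rewrite leq_subr.
have size1 (bs : n.-tuple bool) : size (expand M bs) == (M * n)%N.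
  by rewrite size_expand // size_tuple.
pose F (x : n.-tuple bool * L.-tuple step) := (x.2, Tuple (size1 x.1)).
have FI : injective F.
  move=> [bs g] [cs h] e; have /= -> := congr1 fst e.
  by have /expand_inj/val_inj /= -> := congr1 (fun x => val x.2) e.
have size2 (x : n.-tuple bool * L.-tuple step) :
    size (weave M x.1 x.2) == (n + L)%N.
  by rewrite size_weave !size_tuple.
pose W x := Tuple (size2 x).
have WI : injective W.
  move=> [bs g] [cs h] /(congr1 val) /= /weave_inj.
  by rewrite !size_tuple => -[] // /val_inj -> /val_inj ->.
(* Both sides have [2 ^ (n + L)] elements, so injectivity suffices. *)
have WB : bijective W.
  apply: inj_card_bij => //; rewrite card_prod !card_tuple card_bool.
  have sK : cancel step_of_bool bool_of_step by case.
  have -> : #|{: step}| = 2%N.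
    by rewrite (bij_eq_card (Bijective bool_of_stepK sK)) card_bool.
  by rewrite expnD.
set B := [set w | _].
have -> : path_pairs k n eps delta%:Z = F @: (W @^-1: B).
  (* Conditions (1) to (4) for an expanded path; condition (5) is what being an expansion means. *)
  have key (bs : n.-tuple bool) (g : L.-tuple step) :
      [&& starts_with E (expand M bs), starts_with N g,
          meet_only_at_origin g (expand M bs)
        & (endpoint (expand M bs)).1%:Z - (endpoint g).1%:Z == delta%:Z]
      = (W (bs, g) \in B).
    have hs : (size g + eps = M * size bs)%N by rewrite !size_tuple subnK.
    have hgs : (size g <= M * size bs)%N by rewrite -hs leq_addr.
    have hw := count_weave M bs g hgs.
    have -> : (W (bs, g) \in B)
        = ballot k 0 (weave M bs g) && (count id (weave M bs g) == n - delta)%N.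
      by rewrite inE.
    have -> : ((endpoint (expand M bs)).1%:Z - (endpoint g).1%:Z == delta%:Z)
        = (count id (weave M bs g) == n - delta)%N.
      rewrite /fst /endpoint count_expand.
      rewrite size_tuple in hw; apply/eqP/eqP; lia.
    case: eqP => hc; last by rewrite !andbF.
    rewrite !andbT.
    have hd : (0 + count id bs = delta + count_mem E g)%N.
      rewrite size_tuple in hw; lia.
    case hE: (starts_with E (expand M bs)); last first.
      apply/esym/negbTE; apply: contraFN hE.
      by apply: ballot_weave_starts; apply: ltnW.
    have -> : k = M.+1 by rewrite /M; lia.
    have := above_weave M 0 eps delta bs g M0 hs hed hd.
    rewrite muln0 => <-.
    rewrite andTb; apply: above_meet => //; last by rewrite size_expand.
    by rewrite -size_eq0 (eqP (size1 bs)) muln_eq0 negb_or -!lt0n M0.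
  apply/setP => -[g p]; rewrite inE /=; apply/idP/imsetP.
    case/and5P => h1 h2 h3 h4 h5.
    have [bs ep] : exists bs, p = expand M bs :> seq step.
      by apply: expand_surj; rewrite // -subn1 -subnDA.
    have hbs : size bs == n.
      by rewrite -(eqn_pmul2l M0) -size_expand // -ep size_tuple.
    exists (Tuple hbs, g); last by congr pair; apply: val_inj.
    by rewrite inE -key /= -ep h1 h2 h3 h4.
  case=> -[bs h] /[!inE] hW [-> ->] /=.
  have := key bs h; rewrite inE hW => /and4P [-> -> -> ->] /=.
  by have := runs_expand M bs M0; rewrite -subn1 -subnDA.
rewrite card_imset // on_card_preimset //.
exact: onW_bij.
Qed.

Theorem theorem2p6 (k n eps eps1 eps2 : nat)
    (hk : (2 <= k)%N) (hn : (1 <= n)%N) (heps : (eps <= (k - 1) * n)%N)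
    (heps12 : eps = ((k - 1) * eps1 + eps2)%N) (heps2 : (eps2 <= k - 1)%N)
    (delta : nat) (hdelta : (1 <= delta <= n)%N)
    (hor : (eps1 < delta)%N \/ (eps <= (k - 1) * delta)%N) :
  #|path_pairs k n eps delta%:Z|%:R
    = fps_exp (kCatalan_fps k) (k * delta - eps)%N (n - delta)%N
  /\ fps_exp (kCatalan_fps k) (k * delta - eps)%N (n - delta)%N
    = ((k * delta)%:R - eps%:R) / ((k * n)%:R - eps%:R)
      * 'C((k * n - eps)%N, (n - delta)%N)%:R.
Proof.
(* Both alternatives give this bound: if [eps1 < delta], then [eps <= (k - 1) * (eps1 + 1)] because
   [eps2 <= k - 1]. *)
have hed : (eps <= (k - 1) * delta)%N.
  case: hor => // lt_eps1; rewrite heps12.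
  apply: leq_trans (leq_mul (leqnn (k - 1)%N) lt_eps1).
  by rewrite mulnS addnC leq_add2r.
have k0 : (0 < k)%N by apply: ltnW.
have /andP [d0 hdn] := hdelta.
have hkd : (eps <= k * delta)%N.
  by apply: leq_trans hed _; rewrite leq_mul2r leq_subr orbT.
have hkn : (k * (n - delta) + (k * delta - eps) = k * n - eps)%N.
  by rewrite addnBA // -mulnDr subnK.
(* The words of [card_path_pairs] end at height [k * delta - eps], the exponent of the series. *)
have hlen : (n + ((k - 1) * n - eps) = k * (n - delta) + (k * delta - eps))%N.
  by rewrite hkn addnBA // -mulSn subn1 prednK.
rewrite fps_exp_kCatalan //; split.
  by rewrite card_path_pairs // (card_ballot k _ _ _ k0 hlen).
have eps_kn : (eps < k * n)%N.
  by apply: leq_ltn_trans heps _; rewrite ltn_pmul2r // subn1 prednK.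
by rewrite raneyE hkn ?subn_gt0 // !natrB // ltnW.
Qed.
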